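(* A connected graph $G$ with order $n$ satisfies $\mathrm{vp}(G) = n-1$ if and only if $G$ contains a universal vertex, whilst $\mathrm{vp}^-(G) = n-1$ if and only if $G$ is a complete graph.
   Context: All graphs are finite, undirected and simple. A universal vertex is a vertex adjacent to all other vertices. A $u,v$-geodesic is a shortest $u,v$-path. For a vertex $x$ of $G$, a set $S \subseteq V(G)$ is an $x$-position set if for every $y \in S$ no vertex of $S \setminus \{y\}$ lies on any $x,y$-geodesic in $G$. The $x$-position number $p_x(G)$ is the maximum cardinality of an $x$-position set of $G$. Define $\mathrm{vp}(G) = \max_{x \in V(G)} p_x(G)$ and $\mathrm{vp}^-(G) = \min_{x \in V(G)} p_x(G)$.
   Formalization: The order n is assumed to be at least 2; for the one-vertex graph the claim fails, since vp = vp^- = 1 while n - 1 = 0, although that graph is complete and its vertex is (vacuously) universal. *)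

(* Defs.v *)
From mathcomp Require Import all_boot.
From mathcomp Require Import boolp.

Set Implicit Arguments.
Unset Strict Implicit.
Unset Printing Implicit Defensive.

(* A finite simple graph is a symmetric irreflexive relation e on a finType T.
   As in path.v, a path is given by its first vertex u and the sequence p of
   the remaining vertices; its vertex set is u :: p and its length size p. *)

Section PositionSets.
Variables (T : finType) (e : rel T).

Definition connected_graph : Prop := 0 < #|T| /\ forall u v, connect e u v.

Definition universal (v : T) : Prop := forall u, u != v -> e v u.

Definition complete_graph : Prop := forall u v, u != v -> e u v.

Definition is_path (u v : T) (p : seq T) : bool :=
  [&& path e u p, last u p == v & uniq (u :: p)].

Definition geodesic (u v : T) (p : seq T) : Prop :=
  is_path u v p /\ forall q, is_path u v q -> size p <= size q.

Definition position_set (x : T) (S : {set T}) : Prop :=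
  forall y, y \in S -> forall z, z \in S :\ y ->
  forall p, geodesic x y p -> z \notin x :: p.

Definition position_number (x : T) : nat :=
  \max_(S : {set T} | `[< position_set x S >]) #|S|.

Definition vp : nat := \max_(x : T) position_number x.

(* The default value #|T| is an upper bound of every position number, so it
   does not affect the minimum when T is nonempty. *)
Definition vp_minus : nat := \big[minn/#|T|]_(x : T) position_number x.

End PositionSets.

(* Main.v *)
Require Import Defs.
From mathcomp Require Import all_boot.
From mathcomp Require Import boolp.

(** A vertex [x] lies on every geodesic starting from it, so an [x]-position
    set containing [x] is [[set x]]; hence [p_x <= n - 1]. If equality holds
    and [u] is not adjacent to [x], the second vertex of an [x,u]-geodesic
    would have to be missing from the position set, besides [x]. So
    [p_x = n - 1] exactly when [x] is universal, and both equivalences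
    follow by taking the maximum or the minimum over [x]. *)

Lemma bigmin_leq (I : finType) (m : nat) (F : I -> nat) (i : I) :
  \big[minn/m]_(j : I) F j <= F i.
Proof.
have: i \in index_enum I by rewrite mem_index_enum.
elim: (index_enum I) => //= j r IHr.
rewrite inE big_cons => /predU1P[->|/IHr le_r]; first exact: geq_minl.
exact: leq_trans (geq_minr _ _) le_r.
Qed.

Section PositionNumber.
Set Implicit Arguments.
Unset Strict Implicit.
Variables (T : finType) (e : rel T).

Lemma connect_geodesic (u v : T) :
  connect e u v -> exists p, geodesic e u v p.
Proof.
move=> /connectP[p0 ep0 v_last].
(* Minimise over lengths of repetition-free paths; [shortenP] shows that some length occurs. *)
have: exists k, `[< exists2 p, is_path e u v p & size p = k >].
  case/shortenP: ep0 v_last => p ep up _ v_last.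
  by exists (size p); apply/asboolP; exists p; rewrite // /is_path ep up -v_last eqxx.
move=> ex_k; case: (ex_minnP ex_k) => k /asboolP[p puv szp] min_k.
by exists p; split=> // q quv; rewrite szp min_k //; apply/asboolP; exists q.
Qed.

Hypothesis e_conn : connected_graph e.

Lemma geodesic_ex (u v : T) : exists p, geodesic e u v p.
Proof. by apply: connect_geodesic; apply: e_conn.2. Qed.

Lemma position_set_root (x : T) (S : {set T}) :
  position_set e x S -> x \in S -> S = [set x].
Proof.
move=> posS xS; apply/setP=> y; rewrite in_set1; apply/idP/eqP=> [yS|-> //].
apply/eqP/negPn/negP=> neq_yx; have [p geo_p] := geodesic_ex x y.
have := posS y yS x; rewrite !inE xS eq_sym neq_yx.
by move=> /(_ isT p geo_p); rewrite mem_head.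
Qed.

Lemma position_number_attained (x : T) :
  exists2 S, position_set e x S & position_number e x = #|S|.
Proof.
(* The empty set makes the family nonempty, so that its maximum is attained. *)
have pos0 : `[< position_set e x set0 >].
  by apply/asboolP=> y; rewrite inE.
have [S /asboolP posS cardS] :=
  @eq_bigmax_cond _ [pred S | `[< position_set e x S >]] (fun S => #|S|)
    (introT card_gt0P (ex_intro _ set0 pos0)).
by exists S.
Qed.

Hypothesis card_gt1 : 1 < #|T|.

(** Two vertices are needed: in a one-vertex graph [[set x]] is an [x]-position set of size
    [#|T|]. *)
Lemma position_number_le (x : T) : position_number e x <= #|T|.-1.
Proof.
have [S posS ->] := position_number_attained x.
have [xS|xNS] := boolP (x \in S).
  by rewrite (position_set_root posS xS) cards1 -ltnS prednK // ltnW.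
rewrite -(cardsC1 x); apply/subset_leq_card/subsetP=> y yS.
by rewrite !inE; apply: contraNneq xNS => <-.
Qed.

(** Comparison with the edge from [x] to [y] bounds each geodesic to [y] by length one, so it has no
    inner vertex. *)
Lemma universal_position_set (x : T) :
  universal e x -> position_set e x [set~ x].
Proof.
move=> univ_x y; rewrite !inE => neq_yx z; rewrite !inE => /andP[neq_zy neq_zx].
move=> p [/and3P[_ /eqP last_p _]] /(_ [:: y]).
rewrite /is_path /= univ_x // eqxx inE eq_sym neq_yx => /(_ isT) szp.
case: p szp last_p => [|w [|//]] _ /= => [|->].
  by move=> eq_xy; rewrite eq_xy eqxx in neq_yx.
by rewrite !inE negb_or neq_zx.
Qed.

Lemma position_numberP (x : T) :
  position_number e x = #|T|.-1 <-> universal e x.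
Proof.
split=> [pE u neq_ux|univ_x]; last first.
  apply/eqP; rewrite eqn_leq position_number_le -(cardsC1 x).
  apply: (@leq_bigmax_cond _ _ (fun S : {set T} => #|S|)).
  exact/asboolP/universal_position_set.
(* If [u] is not adjacent to [x], the second vertex [w] of the geodesic differs from both [x] and
   [u]. *)
have [p geo_p] := geodesic_ex x u; apply/negPn/negP=> nadj.
case: p geo_p => [|w p] geo_p; have [/and3P[/= ep /eqP last_p up] _] := geo_p.
  by rewrite last_p eqxx in neq_ux.
have [exw _] := andP ep.
have neq_wu : w != u by apply: contraNneq nadj => <-.
have neq_wx : w != x.
  by move: up; rewrite inE negb_or eq_sym => /andP[/andP[]].
have [S posS cardS] := position_number_attained x; rewrite pE in cardS.
have [xS|xNS] := boolP (x \in S).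
  (* Here [S] is a singleton, so [#|T|] would be 2, against three distinct vertices. *)
  have : #|[set x; w; u]| <= #|T| by apply: max_card.
  rewrite setUC cardsU1 cards2 !inE (negPf neq_ux) eq_sym (negPf neq_wu) eq_sym neq_wx.
  by rewrite -(prednK (ltnW card_gt1)) cardS (position_set_root posS xS) cards1.
have {xNS} SE : S = [set~ x].
  apply/eqP; rewrite eqEcard cardsC1 cardS leqnn andbT.
  by apply/subsetP=> y yS; rewrite !inE; apply: contraNneq xNS => <-.
(* Both [u] and [w] are in [S], yet [w] lies on the geodesic to [u]. *)
have := posS u _ w _ _ geo_p; rewrite SE !inE neq_ux neq_wu neq_wx eqxx orbT.
by move=> /(_ isT isT).
Qed.

End PositionNumber.

Theorem corollary4p1 (T : finType) (e : rel T) (n : nat)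
    (e_sym : symmetric e) (e_irr : irreflexive e)
    (e_conn : connected_graph e) (card_T : #|T| = n) (n_ge2 : 1 < n) :
  (vp e = n - 1 <-> exists v : T, universal e v) /\
  (vp_minus e = n - 1 <-> complete_graph e).
Proof.
subst n; rewrite subn1.
have pnP := position_numberP e_conn n_ge2.
have pn_le := position_number_le e_conn n_ge2.
split; split.
- have [x vpE] := eq_bigmax (position_number e) e_conn.1.
  by rewrite /vp vpE => /pnP univ_x; exists x.
- case=> x /pnP pE; apply/eqP; rewrite eqn_leq; apply/andP; split.
    by apply/bigmax_leqP=> y _.
  by rewrite -pE; apply: leq_bigmax.
(* Every position number lies between the minimum and [#|T|.-1], so each [u] is universal. *)
- move=> vpE u v neq_uv; apply: (iffLR (pnP u)); last by rewrite eq_sym.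
  by apply/eqP; rewrite eqn_leq pn_le -vpE bigmin_leq.
- move=> compl; have pE x : position_number e x = #|T|.-1.
    by apply/pnP=> u neq_ux; apply: compl; rewrite eq_sym.
  have [x _] := card_gt0P e_conn.1.
  apply/eqP; rewrite eqn_leq -{1}(pE x) bigmin_leq /=.
  (* The default value [#|T|] of the minimum must also satisfy the lower bound. *)
  apply: (big_ind (fun m => #|T|.-1 <= m)) => [|a b le_a le_b|y _].
  + exact: leq_pred.
  + by rewrite leq_min le_a.
  + by rewrite pE.
Qed.
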